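(* Let $G=(V,E)$ be a finite weighted graph with vertex measure $\mu$, let $k\in\mathbb{N}$ and let $s$ be an $S^1_k$-valued signature on $G$. Let $\delta>1$ and suppose that $(G,s)$ has isoperimetric dimension $\delta$ with isoperimetric constant $c_\delta>0$. Then for every function $f:V\to\mathbb{C}$, $$\left[\sum_{u\in V}|f(u)|^{\frac{\delta}{\delta-1}}\mu(u)\right]^{\frac{\delta-1}{\delta}}\le \frac{3}{c_\delta}\sum_{\{u,v\}\in E} w_{uv}\,|f(u)-s_{uv}f(v)|.$$
   Context: $G=(V,E)$ is an undirected simple finite graph; each edge $\{u,v\}\in E$ carries a weight $w_{uv}=w_{vu}>0$; $\mu:V\to(0,\infty)$ is a vertex measure. For $X\subseteq V$, $X^c=V\setminus X$, $|E(X,X^c)|=\sum_{u\in X}\sum_{v\in X^c}w_{uv}$ (with $w_{uv}=0$ if $u\not\sim v$), and $\mathrm{vol}_\mu(X)=\sum_{u\in X}\mu(u)$. $E^{or}$ is the set of oriented edges $(u,v),(v,u)$ for $\{u,v\}\in E$. $S^1_k=\{\xi^j: j=1,\dots,k\}$ with $\xi=e^{2\pi i/k}$. An $S^1_k$-valued signature is a map $s:E^{or}\to S^1_k$ with $s_{vu}=s_{uv}^{-1}$, writing $s_{uv}=s((u,v))$. For nonempty $V_1\subseteq V$ with induced edge set $E_1$, the frustration index is $\iota^s(V_1)=\min_{\tau:V_1\to S^1_k}\sum_{\{u,v\}\in E_1}w_{uv}|\tau(u)-s_{uv}\tau(v)|$. $(G,s)$ has isoperimetric dimension $\delta$ with isoperimetric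 constant $c_\delta$ if for every nonempty $V_1\subseteq V$: $\iota^s(V_1)+|E(V_1,V_1^c)|\ge c_\delta\,\mathrm{vol}_\mu(V_1)^{(\delta-1)/\delta}$. *)

(* Defs.v *)
From HB Require Import structures.
From mathcomp Require Import all_boot all_order all_algebra.
From mathcomp Require Import complex.
From mathcomp Require Import all_classical all_reals all_analysis.

Set Implicit Arguments.
Unset Strict Implicit.
Unset Printing Implicit Defensive.

Import Order.TTheory GRing.Theory Num.Theory.
Import numFieldNormedType.Exports.

Local Open Scope classical_set_scope.
Local Open Scope ring_scope.
Local Open Scope complex_scope.

(* [Normc.normc] is the modulus of a complex number as an element of [R];
   the generic norm on [R[i]] takes its values in [R[i]]. *)
Notation cmod := (@Normc.normc _).

Record weighted_graph (R : realType) (V : finType) := WeightedGraph {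
  adj : rel V;
  weight : V -> V -> R;
  vmeasure : V -> R;
  adj_sym : symmetric adj;
  adj_irr : irreflexive adj;
  weight_sym : forall u v, weight u v = weight v u;
  weight_gt0 : forall u v, adj u v -> 0 < weight u v;
  weight_eq0 : forall u v, ~~ adj u v -> weight u v = 0;
  vmeasure_gt0 : forall u, 0 < vmeasure u }.

(* xi = e^(2 pi i / k) *)
Definition xi (R : realType) (k : nat) : R[i] :=
  cos (2 * pi / k%:R) +i* sin (2 * pi / k%:R).

Definition S1 (R : realType) (k : nat) : set R[i] :=
  [set xi R k ^+ j | j in [set j : nat | (1 <= j <= k)%N]].

Section Graph.
Variables (R : realType) (V : finType) (G : weighted_graph R V).

(* A signature is defined on oriented edges only: the values of [s] on
   non-adjacent pairs are unconstrained and never used. *)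
Definition is_signature (k : nat) (s : V -> V -> R[i]) : Prop :=
  forall u v, adj G u v -> S1 k (s u v) /\ s v u = (s u v)^-1.

(* Sum over the unordered edges {u, v} with both endpoints in [X].  Each edge
   contributes once, with the orientation given by the enumeration of [V];
   this is independent of the orientation when [F] is symmetric on edges
   ([edge_sumE]), as are the summands used below ([edge_defect_sym]). *)
Definition edge_sum (X : {set V}) (F : V -> V -> R) : R :=
  \sum_(u in X)
    \sum_(v in X | adj G u v && (enum_rank u < enum_rank v)%N) F u v.

Definition edge_defect (s : V -> V -> R[i]) (g : V -> R[i]) (u v : V) : R :=
  weight G u v * cmod (g u - s u v * g v).

Definition vol (X : {set V}) : R := \sum_(u in X) vmeasure G u.

Definition cut (X : {set V}) : R :=
  \sum_(u in X) \sum_(v | v \notin X) weight G u v.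

(* The infimum is over a finite nonempty set, hence a minimum
   ([frustration_index_le], [frustration_index_attained]).  Only the values of
   [tau] on [X] matter. *)
Definition frustration_index (k : nat) (s : V -> V -> R[i]) (X : {set V}) : R :=
  inf [set edge_sum X (edge_defect s tau) |
       tau in [set tau : V -> R[i] | forall u, u \in X -> S1 k (tau u)]].

Definition has_isoperimetric_dimension (k : nat) (s : V -> V -> R[i])
    (delta c : R) : Prop :=
  forall X : {set V}, (0 < #|X|)%N ->
    c * vol X `^ ((delta - 1) / delta) <= frustration_index k s X + cut X.

Lemma edge_sumE (X : {set V}) (F : V -> V -> R) :
  (forall u v, adj G u v -> F u v = F v u) ->
  edge_sum X F *+ 2 = \sum_(u in X) \sum_(v in X | adj G u v) F u v.
Proof.
move=> symF; rewrite mulr2n {2}/edge_sum.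
rewrite (exchange_big_dep (fun v => v \in X)) /=; last by move=> u v _ /andP[].
rewrite /edge_sum -big_split /=; apply: eq_bigr => u uX.
rewrite [RHS](bigID (fun v => (enum_rank u < enum_rank v)%N)) /=; congr (_ + _).
  by apply: eq_bigl => v; rewrite andbA.
under eq_bigl => v do rewrite uX /=.
rewrite (eq_bigl (fun v => ((v \in X) && adj G u v) &&
                           ~~ (enum_rank u < enum_rank v)%N)); last first.
  move=> v; rewrite (adj_sym G v u) -leqNgt [(enum_rank v <= _)%N]leq_eqVlt.
  have [->|vu] := eqVneq v u; first by rewrite (adj_irr G) !(andbF, andFb).
  have -> : (nat_of_ord (enum_rank v) == enum_rank u) = false.
    by apply/negbTE; apply: contra vu => /eqP/val_inj/enum_rank_inj ->.
  by rewrite orFb andbA.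
by apply: eq_bigr => v /andP[/andP[_ uv] _]; rewrite symF // (adj_sym G).
Qed.

Lemma cmod_S1 k (z : R[i]) : S1 k z -> cmod z = 1.
Proof.
move=> [j _ <-]; elim: j => [|j IH]; first by rewrite expr0 Normc.normc1.
by rewrite exprS Normc.normcM IH mulr1 /= cos2Dsin2 sqrtr1.
Qed.

Lemma edge_defect_sym k s g u v : is_signature k s -> adj G u v ->
  edge_defect s g u v = edge_defect s g v u.
Proof.
move=> sP /sP[/cmod_S1 s1 sV]; rewrite /edge_defect (weight_sym G); congr (_ * _).
have s0 : s u v != 0.
  by apply/eqP => s0; move: s1; rewrite s0 Normc.normc0 => /esym/eqP; rewrite oner_eq0.
rewrite -[RHS]mul1r -{1}s1 -Normc.normcM sV mulrBr mulrA divff // mul1r.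
by rewrite -opprB normcN.
Qed.

Lemma frustration_costs_lb (k : nat) (s : V -> V -> R[i]) (X : {set V}) :
  has_lbound [set edge_sum X (edge_defect s tau) |
    tau in [set tau : V -> R[i] | forall u, u \in X -> S1 k (tau u)]].
Proof.
exists 0 => _ [tau _ <-]; apply: sumr_ge0 => u _; apply: sumr_ge0 => v.
move=> /and3P[_ /(@weight_gt0 _ _ G)/ltW w0 _].
by apply: mulr_ge0 => //; case: (_ - _) => a b; rewrite sqrtr_ge0.
Qed.

Lemma frustration_index_le k s (X : {set V}) (tau : V -> R[i]) :
  (forall u, u \in X -> S1 k (tau u)) ->
  frustration_index k s X <= edge_sum X (edge_defect s tau).
Proof. by move=> tauX; apply: ge_inf; [exact: frustration_costs_lb|exists tau]. Qed.

Lemma frustration_index_attained k s (X : {set V}) : (0 < k)%N ->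
  exists2 tau : V -> R[i], (forall u, u \in X -> S1 k (tau u)) &
    frustration_index k s X = edge_sum X (edge_defect s tau).
Proof.
case: k => // k _.
pose T (a : {ffun V -> 'I_k.+1}) u := xi R k.+1 ^+ (a u).+1.
have TP a u : S1 k.+1 (T a u) by exists (a u).+1 => //=; exact: ltn_ord.
pose F a := edge_sum X (edge_defect s (T a)).
case: (arg_minP F (erefl : xpredT [ffun=> ord0])) => a _ aP.
exists (T a) => //; apply/eqP; rewrite eq_le frustration_index_le //=.
apply: lb_le_inf; first by exists (F a); exists (T a).
move=> _ [tau tauX <-].
have /choice[b bP] u : exists j : 'I_k.+1, u \in X -> tau u = xi R k.+1 ^+ j.+1.
  have [uX|] := boolP (u \in X); last by exists ord0.
  have [[|j] //= jk <-] := tauX u uX.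
  by exists (Ordinal jk).
suff -> : edge_sum X (edge_defect s tau) = F (finfun b) by exact: aP.
apply: eq_bigr => u uX; apply: eq_bigr => v /andP[vX _].
by rewrite /edge_defect /T !ffunE -!bP.
Qed.

End Graph.

(* Main.v *)
(** Cut [f] at the levels of its modulus, X_t = {u : t <= |f u|}, and on X_t
round the phase of [f], rotated by a uniform angle, down to S^1_k.  Each such
X_t and rounding is a competitor for the frustration index, so the isoperimetric
inequality bounds c vol(X_t)^(1/p), p = delta / (delta - 1), by a frustration
cost plus a cut.  Averaged over the rotation, the rounded phases of the two ends
of an edge are no farther apart than the phases themselves, because sine is
concave on [0, pi].  Integrated over t, an edge thus contributes at most
min(|z1|, |z2|) |z1/|z1| - z2/|z2|| + ||z1| - |z2|| <= 3 |z1 - z2|, where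
z1 = f u and z2 = s u v * f v.  Finally, Minkowski's inequality bounds the L^p
norm of |f| by the integral over t of vol(X_t)^(1/p).  Only finitely many levels
and angles matter, so both integrals are finite weighted sums. *)

Require Import Defs.
From HB Require Import structures.
From mathcomp Require Import all_boot all_order all_algebra.
From mathcomp Require Import complex.
From mathcomp Require Import all_classical all_reals all_analysis.
From mathcomp Require Import ring lra.

Set Implicit Arguments.
Unset Strict Implicit.
Unset Printing Implicit Defensive.

Import Order.TTheory GRing.Theory Num.Theory.
Import numFieldNormedType.Exports.

Local Open Scope ring_scope.

(** * Concavity of sine on [0, pi] *)

(** The mean value theorem on [[a, x]] and [[x, b]] gives chord slopes [cos c1] and [cos c2] with
    [c1 <= c2], and cosine decreases on [0, pi]. *)
Lemma sin_concave (R : realType) (a b t : R) :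
  0 <= a -> a <= b -> b <= pi -> 0 <= t <= 1 ->
  (1 - t) * sin a + t * sin b <= sin ((1 - t) * a + t * b).
Proof.
move=> a0 ab bpi /andP[t0 t1]; set x := (1 - t) * a + t * b.
have ax : a <= x by rewrite /x; nra.
have xb : x <= b by rewrite /x; nra.
have cont (u v : R) : {within `[u, v], continuous (@sin R)}%classic.
  by apply: continuous_subspaceT => z; exact: continuous_sin.
have [c1 /andP[]] := MVT_segment ax (fun z _ => is_derive_sin z) (cont a x).
rewrite !bnd_simp => ac1 c1x E1.
have [c2 /andP[]] := MVT_segment xb (fun z _ => is_derive_sin z) (cont x b).
rewrite !bnd_simp => xc2 c2b E2.
have cc : cos c2 <= cos c1.
  by rewrite leNgt ltr_cos ?in_itv /= -?leNgt; [exact: le_trans c1x xc2|lra|lra].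
have : 0 <= t * (1 - t) * (b - a) * (cos c1 - cos c2).
  by rewrite !mulr_ge0 ?subr_ge0.
have -> : sin x = (1 - t) * (sin a + cos c1 * (x - a)) + t * (sin b - cos c2 * (b - x)).
  by rewrite -E1 -E2; ring.
rewrite /x; lra.
Qed.

(** * Finite level samples in place of integrals *)

(* Sums over [L] play the role of the integral over levels: a pair in [L] is a
   weight and a level, and [a] is recovered from the indicators [level <= a]. *)
Lemma layer_sample_path (R : realFieldType) (x : R) (A : seq R) :
  path <=%R x A ->
  exists L : seq (R * R), [/\ all (fun p => 0 <= p.1) L,
    forall a, a <= x -> \sum_(p <- L) p.1 * (p.2 <= a)%R%:R = 0 &
    forall a, a \in A -> \sum_(p <- L) p.1 * (p.2 <= a)%R%:R = a - x].
Proof.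
elim: A x => [|y A IH] x /=; first by exists [::]; split => // a _; rewrite big_nil.
move=> /andP[xy yA]; have [L [L0 Lle LA]] := IH y yA.
have Ly a : a \in y :: A -> \sum_(p <- L) p.1 * (p.2 <= a)%R%:R = a - y.
  by rewrite inE => /orP[/eqP->|/LA//]; rewrite Lle ?subrr.
have yle a : a \in y :: A -> y <= a.
  rewrite inE => /orP[/eqP->//|aA].
  by move: yA; rewrite path_sortedE; [case/andP => /allP/(_ a aA)|exact: le_trans].
(* Every value in [y :: A] is at least [y], so level [y] with weight [y - x] adds the missing gap.
   For [a <= x] it counts only if [y = x], when its weight is 0. *)
exists ((y - x, y) :: L); split => [|a ax|a aA].
- by rewrite /= subr_ge0 xy.
- rewrite big_cons Lle /= ?(le_trans ax) // addr0.
  have [ya|] := boolP (y <= a); last by rewrite mulr0.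
  by rewrite (le_anti (_ : x <= y <= x)) ?subrr ?mul0r // xy (le_trans ya).
- by rewrite big_cons Ly //= yle // mulr1 addrC addrA subrK.
Qed.

Lemma layer_sample (R : realFieldType) (A : seq R) :
  (forall a, a \in A -> 0 <= a) ->
  exists L : seq (R * R), all (fun p => 0 <= p.1) L /\
    forall a, a \in A -> \sum_(p <- L) p.1 * (p.2 <= a)%R%:R = a.
Proof.
move=> A0; have : path <=%R 0 (sort <=%R A).
  rewrite path_sortedE; last exact: le_trans.
  rewrite sort_le_sorted andbT; apply/allP => a; rewrite mem_sort; exact: A0.
move=> /layer_sample_path[L [L0 _ LA]]; exists L; split => // a aA.
by rewrite LA ?mem_sort // subr0.
Qed.

Lemma unit_interval_sample (R : realFieldType) (A : seq R) :
  (forall a, a \in A -> 0 <= a <= 1) ->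
  exists L : seq (R * R), [/\ all (fun p => 0 <= p.1) L, \sum_(p <- L) p.1 = 1 &
    forall a, a \in A -> \sum_(p <- L) p.1 * (p.2 <= a)%R%:R = a].
Proof.
move=> A01; have [a|L [L0 LA]] := @layer_sample R (1 :: A).
  by rewrite inE => /orP[/eqP->|/A01/andP[]].
exists [seq p <- L | p.2 <= 1]; split => [||a aA].
- by apply/allP => p; rewrite mem_filter => /andP[_ /(allP L0)].
- rewrite big_filter -[RHS](LA 1) ?mem_head // big_mkcond /=.
  by apply: eq_bigr => p _; case: ifP; rewrite (mulr1, mulr0).
- rewrite big_filter -[RHS](LA a) ?inE ?aA ?orbT // big_mkcond /=.
  apply: eq_bigr => p _; case: ifPn => // p1.
  rewrite (_ : (p.2 <= a) = false) ?mulr0 //; apply: contraNF p1.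
  by move=> /le_trans->//; case/andP: (A01 a aA).
Qed.

(** * Rotations and the k-th roots of unity *)

Section Rotation.
Variables (R : realType) (k : nat).
Hypothesis k0 : (0 < k)%N.

(** Angles are measured in units of 2 pi / k, so that integers give the elements of S^1_k and
    rounding a phase down is taking its floor. *)
Let angle (x : R) : R := 2 * pi / k%:R * x.

Definition rot (x : R) : R[i] := (cos (angle x) +i* sin (angle x))%C.

Let kR0 : k%:R != 0 :> R. Proof. by rewrite pnatr_eq0 -lt0n. Qed.

Lemma rotD x y : rot (x + y) = rot x * rot y.
Proof.
rewrite /rot /angle mulrDr cosD sinD; simpc.
by congr (_ +i* _)%C; rewrite addrC [RHS]addrC // [in RHS]mulrC addrC mulrC.
Qed.

Lemma rot0 : rot 0 = 1.
Proof. by rewrite /rot /angle mulr0 cos0 sin0. Qed.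

Lemma rot_nat (n : nat) : rot n%:R = xi R k ^+ n.
Proof.
elim: n => [|n IH]; first by rewrite rot0 expr0.
by rewrite -natr1 rotD IH exprSr /xi /rot /angle mulr1.
Qed.

Lemma rot_period : rot k%:R = 1.
Proof. by rewrite /rot /angle divfK // mulr_natl cos2pi sin2pi. Qed.

Lemma rotMperiod (m : int) : rot (m%:~R * k%:R) = 1.
Proof.
have nat_case n : rot (n%:R * k%:R) = 1.
  elim: n => [|n IH]; first by rewrite mul0r rot0.
  by rewrite -natr1 mulrDl mul1r rotD IH rot_period mulr1.
case: m => n; first exact: nat_case.
rewrite NegzE rmorphN /= mulNr -[LHS]mulr1 -(nat_case n.+1) -rotD.
by rewrite addNr rot0.
Qed.

Lemma cmod_rot x : cmod (rot x) = 1.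
Proof. by rewrite /= cos2Dsin2 sqrtr1. Qed.

Lemma rot_modz (n : int) x : rot (n%:~R + x) = rot ((n %% k)%Z%:~R + x).
Proof.
rewrite {1}(divz_eq n k) rmorphD rmorphM /= -addrA rotD.
by rewrite rotMperiod mul1r.
Qed.

Lemma S1_rot (n : int) : S1 k (rot n%:~R).
Proof.
rewrite -[n%:~R]addr0 rot_modz addr0.
have : (0 <= n %% k)%Z by apply: modz_ge0; rewrite -lt0n.
have : (n %% k < k)%Z by apply: ltz_pmod.
case: (n %% k)%Z => // j jk _; rewrite -pmulrn rot_nat.
case: j jk => [|j] jk; last by exists j.+1 => //=; exact: (@ltnW j.+1 k jk).
(* The exponents in [S1] run from 1 to k, so residue 0 is represented by k. *)
by exists k; rewrite /= ?k0 ?leqnn // expr0 -rot_nat rot_period.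
Qed.

Lemma S1_is_rot (z : R[i]) : S1 k z -> exists m : nat, z = rot m%:R.
Proof. by case=> j _ <-; exists j; rewrite rot_nat. Qed.

Lemma polar_form (z : R[i]) : exists x : R, z = (cmod z)%:C%C * rot x.
Proof.
have [->|z0] := eqVneq z 0; first by exists 0; rewrite Normc.normc0 mul0r.
pose r := cmod z; have r0 : 0 < r.
  rewrite lt_neqAle eq_sym; apply/andP; split; last by rewrite /r; case: z {z0 r} => a b; rewrite sqrtr_ge0.
  by apply: contra z0 => /eqP/Normc.eq0_normc->.
case: z @r r0 {z0} => a b r r0.
have r2 : r ^+ 2 = a ^+ 2 + b ^+ 2 by rewrite sqr_sqrtr // addr_ge0 ?sqr_ge0.
have ar : -1 <= a / r <= 1.
  by rewrite ler_pdivrMr // ler_pdivlMr // mul1r mulN1r; nra.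
have sb : sin (acos (a / r)) = `|b / r|.
  rewrite sin_acos // -sqrtr_sqr; congr Num.sqrt.
  rewrite !expr_div_n (_ : b ^+ 2 = r ^+ 2 - a ^+ 2); last by rewrite r2 addrC addKr.
  by rewrite mulrBl divff // expf_neq0 ?lt0r_neq0.
(* [acos] fixes the angle only up to sign; the sign of the imaginary part decides. *)
have [t [ct st]] : exists t : R, cos t = a / r /\ sin t = b / r.
  have [b0|b0] := lerP 0 (b / r).
    by exists (acos (a / r)); rewrite acosK ?in_itv // sb ger0_norm.
  by exists (- acos (a / r)); rewrite cosN sinN acosK ?in_itv // sb ltr0_norm ?opprK.
exists (t * k%:R / (2 * pi)).
have pi0 : pi != 0 :> R by rewrite lt0r_neq0 // pi_gt0.
rewrite /rot (_ : angle _ = t); last first.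
  by rewrite /angle; move: (pi : R) (k%:R : R) pi0 kR0 => p q p0 q0; field; rewrite p0 q0.
rewrite ct st -/r; simpc.
by congr (_ +i* _)%C; rewrite mulrC divfK // lt0r_neq0.
Qed.

Lemma cmod_rotB x y : cmod (rot x - rot y) = 2 * `|sin (pi / k%:R * (x - y))|.
Proof.
have -> : rot x - rot y = rot y * (rot (x - y) - 1).
  by rewrite mulrBr mulr1 -rotD [y + _]addrC subrK.
rewrite Normc.normcM cmod_rot mul1r.
set w := pi / k%:R * (x - y).
have -> : rot (x - y) = (cos (w + w) +i* sin (w + w))%C.
  by rewrite /rot (_ : angle _ = w + w) // /angle /w; ring.
rewrite [LHS]/= -[2 in RHS]ger0_norm // -normrM -sqrtr_sqr; congr Num.sqrt.
rewrite cosD sinD oppr0 addr0; have := cos2Dsin2 w.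
set c := cos w; set s := sin w => /(canRL (addrK _)) c2.
transitivity ((c ^+ 2 - s ^+ 2 - 1) ^+ 2 + 4 * s ^+ 2 * c ^+ 2); first ring.
by rewrite c2; ring.
Qed.

End Rotation.

(** * The modulus and polar coordinates *)

Section Modulus.
Variable R : realType.
Implicit Types z : R[i].

Lemma cmod_ge0 z : 0 <= cmod z.
Proof. by case: z => a b; exact: sqrtr_ge0. Qed.

Lemma cmod_distC z1 z2 : cmod (z1 - z2) = cmod (z2 - z1).
Proof. by rewrite -opprB normcN. Qed.

Lemma cmod_real (a : R) : cmod a%:C%C = `|a|.
Proof. by rewrite /= expr0n /= addr0 sqrtr_sqr. Qed.

Lemma ler_cmod_dist z1 z2 : `|cmod z1 - cmod z2| <= cmod (z1 - z2).
Proof.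
have sub z z' : cmod z - cmod z' <= cmod (z - z').
  by rewrite lerBlDr -{1}(subrK z' z); exact: le_normcD.
by rewrite ler_norml sub andbT lerNl opprB cmod_distC.
Qed.

(* The constant 3: the smaller radius times the distance of the directions is
   at most [cmod (z1 - z2) + `|a - b|]. *)
Lemma polar_dist (a b : R) z1 z2 : 0 <= a -> 0 <= b -> cmod z1 = 1 -> cmod z2 = 1 ->
  Num.min a b * cmod (z1 - z2) + `|a - b| <= 3 * cmod (a%:C%C * z1 - b%:C%C * z2).
Proof.
wlog ab : a b z1 z2 / a <= b => [H a0 b0 h1 h2|a0 b0 h1 h2].
  have [ab|/ltW ba] := leP a b; first by have := H a b z1 z2 ab a0 b0 h1 h2; rewrite min_l.
  by have := H b a z2 z1 ba b0 a0 h2 h1; rewrite min_l // distrC cmod_distC [X in 3 * X]cmod_distC.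
rewrite min_l //.
have -> : a * cmod (z1 - z2) = cmod (a%:C%C * (z1 - z2)).
  by rewrite Normc.normcM cmod_real ger0_norm.
set d := cmod (_ - _ * z2).
have dab : `|a - b| <= d.
  have := ler_cmod_dist (a%:C%C * z1) (b%:C%C * z2).
  by rewrite !Normc.normcM h1 h2 !mulr1 !cmod_real (ger0_norm a0) (ger0_norm b0).
(* Changing the second radius from [b] to [a] costs |a - b|, so the left-hand side is at most d + 2
   |a - b| <= 3 d. *)
have -> : a%:C%C * (z1 - z2) = (a%:C%C * z1 - b%:C%C * z2) + (b - a)%:C%C * z2.
  by rewrite rmorphB /= mulrBl mulrBr addrA subrK.
have := le_normcD (a%:C%C * z1 - b%:C%C * z2) ((b - a)%:C%C * z2).
rewrite -/d Normc.normcM h2 mulr1 cmod_real distrC; lra.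
Qed.

End Modulus.

(** * Randomised rounding of phases *)

Section Rounding.
Variables (R : realType) (k : nat).
Hypothesis k0 : (0 < k)%N.

(** After reduction modulo k the half angles lie between pi r / k and pi (r + 1) / k with r + 1 <=
    k, hence in [0, pi], where sine is nonnegative and concave. *)
Lemma chord_interpolation (D : int) (t : R) : 0 <= t <= 1 ->
  (1 - t) * cmod (rot k D%:~R - rot k 0) + t * cmod (rot k (D%:~R + 1) - rot k 0)
    <= cmod (rot k (D%:~R + t) - rot k (0 : R)).
Proof.
move=> t01; rewrite -[D%:~R in X in X + _]addr0 !(rot_modz k0 D) addr0.
have : (0 <= D %% k)%Z by apply: modz_ge0; rewrite -lt0n.
have : (D %% k < k)%Z by apply: ltz_pmod.
case: (D %% k)%Z => // r rk _; rewrite -pmulrn !cmod_rotB !subr0.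
have kR : 0 < k%:R :> R by rewrite ltr0n.
have pik : 0 <= pi / k%:R :> R by rewrite divr_ge0 ?pi_ge0 ?ler0n.
have sin_ge0 (x : R) : 0 <= x <= k%:R -> 0 <= sin (pi / k%:R * x).
  move=> /andP[x0 xk]; apply: sin_ge0_pi; rewrite mulr_ge0 //=.
  by rewrite mulrAC ler_pdivrMr // ler_wpM2l ?pi_ge0.
have r0 : 0 <= r%:R :> R := ler0n _ _.
have rk1 : r%:R + 1 <= k%:R :> R by rewrite natr1 ler_nat.
have t0 : 0 <= t by case/andP: t01.
have t1 : t <= 1 by case/andP: t01.
rewrite !ger0_norm ?sin_ge0 //; try (by apply/andP; split; lra).
have := @sin_concave R (pi / k%:R * r%:R) (pi / k%:R * (r%:R + 1)) t.
move=> /(_ _ _ _ t01) => H.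
have -> : pi / k%:R * (r%:R + t) = (1 - t) * (pi / k%:R * r%:R) + t * (pi / k%:R * (r%:R + 1)) by ring.
have {}H := H (mulr_ge0 pik r0) (ler_wpM2l pik (_ : r%:R <= r%:R + 1)).
rewrite mulrCA [t * (2 * _)]mulrCA -mulrDr ler_pM2l //; apply: H; first lra.
by rewrite mulrAC ler_pdivrMr // ler_wpM2l ?pi_ge0.
Qed.

(* [m] and [x] are the integer and fractional parts of a phase in units of
   2 pi / k; adding a random angle before rounding down gives [m] or [m + 1],
   the latter with probability [x]. *)
Lemma expected_rounding (L : seq (R * R)) (m n : int) (x y : R) :
  \sum_(p <- L) p.1 = 1 ->
  \sum_(p <- L) p.1 * (p.2 <= x)%R%:R = x ->
  \sum_(p <- L) p.1 * (p.2 <= y)%R%:R = y -> all (fun p => 0 <= p.1) L ->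
  0 <= x <= 1 -> 0 <= y <= 1 ->
  \sum_(p <- L) p.1 * cmod (rot k (m%:~R + (p.2 <= x)%R%:R) -
                            rot k (n%:~R + (p.2 <= y)%R%:R))
    <= cmod (rot k (m%:~R + x) - rot k (n%:~R + y)).
Proof.
wlog yx : m n x y / y <= x => [H|].
  have [yx|/ltW xy] := leP y x; first exact: H.
  move=> L1 Lx Ly L0 hx hy; rewrite cmod_distC.
  by under eq_bigr do rewrite cmod_distC; exact: H.
move=> L1 Lx Ly L0 /andP[x0 x1] /andP[y0 y1].
have t01 : 0 <= x - y <= 1 by apply/andP; split; lra.
have := chord_interpolation (m - n) t01; rewrite intrB.
set A := cmod (rot k (_ - _) - _).
set B := cmod (rot k (_ - _ + 1) - _) => AB.
suff -> : \sum_(p <- L) p.1 * cmod (rot k (m%:~R + (p.2 <= x)%R%:R) -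
    rot k (n%:~R + (p.2 <= y)%R%:R)) = (1 - (x - y)) * A + (x - y) * B.
  apply: le_trans AB _; rewrite !cmod_rotB subr0.
  by rewrite (_ : m%:~R - n%:~R + (x - y) = m%:~R + x - (n%:~R + y)) //; ring.
(* Since [y <= x], the second phase never rounds up alone. If both or neither round up, the distance
   is [A]; if only the first does, it is [B], with total weight [x - y]. *)
transitivity (\sum_(p <- L) (p.1 * A + (p.1 * (p.2 <= x)%R%:R - p.1 * (p.2 <= y)%R%:R) * (B - A))).
  apply: eq_bigr => p _; rewrite -mulrBr -mulrA -mulrDr; congr (_ * _).
  rewrite cmod_rotB.
  have [py|py] := boolP (p.2 <= y).
    rewrite (le_trans py yx); transitivity A; last by rewrite /=; ring.
    by rewrite /A cmod_rotB; congr (_ * `|sin (_ * _)|); rewrite /=; ring.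
  case: (p.2 <= x).
    transitivity B; last by rewrite /=; ring.
    by rewrite /B cmod_rotB; congr (_ * `|sin (_ * _)|); rewrite /=; ring.
  transitivity A; last by rewrite /=; ring.
  by rewrite /A cmod_rotB; congr (_ * `|sin (_ * _)|); rewrite /=; ring.
rewrite big_split /= -!mulr_suml sumrB L1 Lx Ly; ring.
Qed.

End Rounding.

(** * Minkowski's inequality for level sets *)

Section Layers.
Variables (R : realType) (L : seq (R * R)).
Hypothesis L0 : all (fun p => 0 <= p.1) L.

Lemma layer_min (a b : R) :
  \sum_(p <- L) p.1 * (p.2 <= a)%R%:R = a -> \sum_(p <- L) p.1 * (p.2 <= b)%R%:R = b ->
  \sum_(p <- L) p.1 * ((p.2 <= a)%R%:R * (p.2 <= b)%R%:R) = Num.min a b.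
Proof.
move=> La Lb; have [ab|/ltW ba] := leP a b.
  rewrite -[RHS]La; apply: eq_bigr => p _; congr (_ * _).
  by have [pa|_] := boolP (p.2 <= a); rewrite ?mul0r // (le_trans pa ab) mulr1.
rewrite -[RHS]Lb; apply: eq_bigr => p _; congr (_ * _).
by have [pb|_] := boolP (p.2 <= b); rewrite ?mulr0 // (le_trans pb ba) mulr1.
Qed.

Lemma layer_dist (a b : R) :
  \sum_(p <- L) p.1 * (p.2 <= a)%R%:R = a -> \sum_(p <- L) p.1 * (p.2 <= b)%R%:R = b ->
  \sum_(p <- L) p.1 * `|(p.2 <= a)%R%:R - (p.2 <= b)%R%:R| = `|a - b|.
Proof.
wlog ab : a b / a <= b => [H|].
  have [ab|/ltW ba] := leP a b; first exact: H.
  by move=> La Lb; under eq_bigr do rewrite distrC; rewrite distrC; exact: H.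
move=> La Lb; rewrite distrC ger0_norm ?subr_ge0 //.
rewrite -[in RHS]La -[X in X - _]Lb -sumrB; apply: eq_bigr => p _.
rewrite -mulrBr distrC ger0_norm // subr_ge0 ler_nat.
by case: (boolP (p.2 <= a)) => // pa; rewrite (le_trans pa ab).
Qed.

(** Split off one factor g from g^p and expand it over levels. Hoelder's inequality on each
    superlevel set then bounds [S] by N^(p - 1) times the right-hand side, where N^p = S. *)
Lemma layer_minkowski (V : finType) (mu g : V -> R) (p : R) :
  1 < p -> (forall u, 0 < mu u) -> (forall u, 0 <= g u) ->
  (forall u, \sum_(q <- L) q.1 * (q.2 <= g u)%R%:R = g u) ->
  (\sum_u g u `^ p * mu u) `^ p^-1
    <= \sum_(q <- L) q.1 * (\sum_(u | q.2 <= g u) mu u) `^ p^-1.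
Proof.
move=> p1 mu0 g0 Lg; set S := \sum_u _.
have p0 : 0 < p by lra.
have S0 : 0 <= S by apply: sumr_ge0 => u _; rewrite mulr_ge0 ?powR_ge0 // ltW.
have rhs0 : 0 <= \sum_(q <- L) q.1 * (\sum_(u | q.2 <= g u) mu u) `^ p^-1.
  by rewrite big_seq sumr_ge0 // => q /(allP L0) ?; rewrite mulr_ge0 ?powR_ge0.
have [->|Sn0] := eqVneq S 0; first by rewrite powR0 // invr_eq0 gt_eqF.
have {Sn0} S_gt0 : 0 < S by rewrite lt_neqAle eq_sym Sn0.
set N := S `^ p^-1; have N0 : 0 < N by rewrite powR_gt0.
have Np : N `^ p = S by rewrite /N -powRrM mulVf ?gt_eqF // powRr1.
have p10 : 0 < p - 1 by lra.
(* Hoelder's inequality for the indicator of [A] and [g ^ (p - 1)]. *)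
have hoelder (A : pred V) :
    \sum_(u | A u) g u `^ (p - 1) * mu u
      <= N `^ (p - 1) * (\sum_(u | A u) mu u) `^ p^-1.
  have [A0|/existsP[u0 Au0]] := boolP [forall u, ~~ A u]; last first.
    set v := \sum_(u | A u) mu u.
    have v0 : 0 < v.
      rewrite /v (bigD1 u0 (negbNE Au0)) /=; apply: (lt_le_trans (mu0 u0)).
      by rewrite lerDl sumr_ge0 // => u _; exact: ltW.
    have M0 : 0 < v `^ p^-1 by rewrite powR_gt0.
    have q0 : 0 < p / (p - 1) by rewrite divr_gt0.
    have conj_pq : p^-1 + (p / (p - 1))^-1 = 1 by field; rewrite !gt_eqF.
    (* Young's inequality for the two factors divided by their norms v^(1/p) and N^(p - 1). Summed
       against [mu] over [A], its right-hand side is at most 1/p + (p - 1)/p = 1. *)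
    have young u : (v `^ p^-1)^-1 * (g u / N) `^ (p - 1)
        <= v^-1 / p + g u `^ p / S / (p / (p - 1)).
      have := conjugate_powR (ltW (_ : 0 < (v `^ p^-1)^-1)) (powR_ge0 (g u / N) (p - 1)) p0 q0 conj_pq.
      rewrite invr_gt0 => /(_ M0) /le_trans; apply.
      rewrite -powRrM [(p - 1) * _]mulrC divfK ?gt_eqF //.
      rewrite -powR_inv1 ?powR_ge0 // -!powRrM.
      rewrite mulN1r mulrN mulVf ?gt_eqF // powR_inv1 ?(ltW v0) //.
      rewrite powRM ?invr_ge0 ?(ltW N0) //.
      by rewrite -[N^-1]powR_inv1 ?(ltW N0) // powRAC Np powR_inv1.
    have : \sum_(u | A u) (v `^ p^-1)^-1 * (g u / N) `^ (p - 1) * mu u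
        <= \sum_(u | A u) (v^-1 / p + g u `^ p / S / (p / (p - 1))) * mu u.
      by apply: ler_sum => u _; rewrite ler_wpM2r // ltW.
    have -> : \sum_(u | A u) (v `^ p^-1)^-1 * (g u / N) `^ (p - 1) * mu u =
        (N `^ (p - 1) * v `^ p^-1)^-1 * \sum_(u | A u) g u `^ (p - 1) * mu u.
      rewrite mulr_sumr; apply: eq_bigr => u _.
      rewrite powRM ?invr_ge0 ?(ltW N0) // -[N^-1]powR_inv1 ?(ltW N0) //.
      rewrite powRAC powR_inv1 ?powR_ge0 // invfM; ring.
    rewrite ler_pdivrMl ?mulr_gt0 ?powR_gt0 // => /le_trans; apply.
    rewrite ler_piMr ?mulr_ge0 ?powR_ge0 // -[leRHS]conj_pq.
    have SA : \sum_(u | A u) g u `^ p * mu u <= S.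
      rewrite /S [leRHS](bigID A) /= lerDl sumr_ge0 // => u _.
      by rewrite mulr_ge0 ?powR_ge0 // ltW.
    under eq_bigr do rewrite mulrDl.
    rewrite big_split /= -mulr_sumr -/v mulrAC mulVf ?gt_eqF // mul1r lerD2l.
    under eq_bigr do rewrite mulrAC.
    rewrite -mulr_suml ler_piMl ?invr_ge0 ?(ltW q0) //.
    under eq_bigr do rewrite mulrAC.
    by rewrite -mulr_suml ler_pdivrMr // mul1r.
  rewrite big_pred0 ?mulr_ge0 ?powR_ge0 // => u.
  by apply/negbTE; exact: (forallP A0).
have SN : S <= N `^ (p - 1) * \sum_(q <- L) q.1 * (\sum_(u | q.2 <= g u) mu u) `^ p^-1.
  have -> : S = \sum_(q <- L) q.1 * \sum_(u | q.2 <= g u) g u `^ (p - 1) * mu u.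
    transitivity (\sum_u \sum_(q <- L) q.1 * ((q.2 <= g u)%R%:R * (g u `^ (p - 1) * mu u))).
      apply: eq_bigr => u _; rewrite -(mulr_powRB1 (g0 u) p0).
      rewrite -[RHS](eq_bigr _ (fun q _ => esym (mulrA _ _ _))) -mulr_suml Lg.
      by rewrite mulrA.
    rewrite exchange_big; apply: eq_bigr => q _ /=.
    rewrite -mulr_sumr; congr (_ * _); rewrite [RHS]big_mkcond.
    by apply: eq_bigr => u _; case: ifP; rewrite ?mul1r ?mul0r.
  rewrite mulr_sumr big_seq [leRHS]big_seq; apply: ler_sum => q /(allP L0) q0.
  by rewrite mulrCA ler_wpM2l // hoelder.
(* As N^(p - 1) N = S, the goal times the positive factor N^(p - 1) is [SN]. *)
rewrite -(ler_pM2l (powR_gt0 (p - 1) N0)) -[X in X <= _]mulrC mulr_powRB1 ?Np //.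
exact: ltW.
Qed.

End Layers.

(** * Averaging the isoperimetric inequality over levels and rotations *)

Section Graph.
Variables (R : realType) (V : finType) (G : weighted_graph R V).

(** Puts the sums for all level sets over one index set, so that averages can be taken edge by
    edge. *)
Lemma edge_sum_restrict (X : {set V}) (F : V -> V -> R) :
  edge_sum G X F =
    edge_sum G [set: V] (fun u v => (u \in X)%:R * (v \in X)%:R * F u v).
Proof.
rewrite /edge_sum big_mkcond [RHS]big_mkcond; apply: eq_bigr => u _; rewrite inE.
have [uX|uX] := boolP (u \in X); last first.
  by rewrite big1 // => v _; rewrite !mul0r.
rewrite big_mkcond [RHS]big_mkcond; apply: eq_bigr => v _; rewrite !inE /=.
by case: (v \in X) => /=; case: ifP; rewrite ?mul1r ?mulr0 ?mul0r.
Qed.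

(** The cut runs over ordered pairs, while [edge_sum] orients each edge by the enumeration of [V].
    Doubling symmetrises both sides, which then agree pair by pair. *)
Lemma cut_edge_sum (X : {set V}) :
  Defs.cut G X = edge_sum G [set: V]
    (fun u v => weight G u v * `|(u \in X)%:R - (v \in X)%:R|).
Proof.
apply: (pmulrnI (isT : (0 < 2)%N)).
rewrite edge_sumE; last by move=> u v _; rewrite weight_sym distrC.
pose T u v := weight G u v * ((u \in X)%:R * (v \notin X)%:R).
have cutE : Defs.cut G X = \sum_u \sum_v T u v.
  rewrite /Defs.cut big_mkcond; apply: eq_bigr => u _; rewrite /T.
  have [uX|uX] := boolP (u \in X); last first.
    by rewrite big1 // => v _; rewrite mul0r mulr0.
  rewrite big_mkcond; apply: eq_bigr => v _.
  by case: (v \in X); rewrite /= ?mulr0 ?mulr1.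
rewrite mulr2n [X in _ + X]cutE exchange_big cutE -big_split [RHS]big_mkcond /=.
apply: eq_bigr => u _; rewrite !inE -big_split [RHS]big_mkcond /=.
apply: eq_bigr => v _; rewrite !inE /= /T (weight_sym G v u) -mulrDr.
have [uv|uv] := boolP (adj G u v); last by rewrite weight_eq0 ?mul0r.
congr (_ * _); case: (u \in X); case: (v \in X) => /=.
- by rewrite subrr normr0; ring.
- by rewrite subr0 normr1; ring.
- by rewrite sub0r normrN normr1; ring.
- by rewrite subrr normr0; ring.
Qed.

Lemma edge_sumD (X : {set V}) (F H : V -> V -> R) :
  edge_sum G X F + edge_sum G X H = edge_sum G X (fun u v => F u v + H u v).
Proof. by rewrite /edge_sum -big_split; under eq_bigr do rewrite -big_split. Qed.

Lemma edge_sumZ (X : {set V}) a (F : V -> V -> R) :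
  a * edge_sum G X F = edge_sum G X (fun u v => a * F u v).
Proof. by rewrite /edge_sum mulr_sumr; under eq_bigr do rewrite mulr_sumr. Qed.

Lemma edge_sum_sum (X : {set V}) (I : Type) (L : seq I) (F : I -> V -> V -> R) :
  \sum_(i <- L) edge_sum G X (F i) =
    edge_sum G X (fun u v => \sum_(i <- L) F i u v).
Proof.
rewrite /edge_sum exchange_big; apply: eq_bigr => u _; exact: exchange_big.
Qed.

Lemma ler_edge_sum (X : {set V}) (F H : V -> V -> R) :
  (forall u v, adj G u v -> F u v <= H u v) -> edge_sum G X F <= edge_sum G X H.
Proof.
by move=> FH; apply: ler_sum => u _; apply: ler_sum => v /and3P[_ uv _]; exact: FH.
Qed.

Lemma isoperimetric_le k s delta c (X : {set V}) (tau : V -> R[i]) :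
  1 < delta -> has_isoperimetric_dimension G k s delta c ->
  (forall u, S1 k (tau u)) ->
  c * vol G X `^ ((delta - 1) / delta)
    <= edge_sum G X (edge_defect G s tau) + Defs.cut G X.
Proof.
move=> d1 iso tauS; have [X0|X0] := posnP #|X|; last first.
  apply: le_trans (iso X X0) _; rewrite lerD2r.
  by apply: frustration_index_le => u _.
(* A level set may be empty, and the isoperimetric hypothesis covers nonempty sets. Here the volume
   is 0, and so is its power, the exponent being nonzero. *)
move/eqP: X0; rewrite cards_eq0 => /eqP ->.
rewrite /vol /edge_sum /Defs.cut !big_set0 powR0 ?mulr0 ?addr0 //.
by rewrite mulf_neq0 ?invr_eq0 // gt_eqF //; lra.
Qed.

(* [f] is cut at all levels [q] of its modulus and rounded to S^1_k after all
   rotations [p]; the weights in [L] and [P] average over both. *)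
Lemma coarea_inequality k (hk : (0 < k)%N) s (hs : is_signature G k s) delta c
    (hdelta : 1 < delta) (hiso : has_isoperimetric_dimension G k s delta c)
    (f : V -> R[i]) (L : seq (R * R)) :
  all (fun q => 0 <= q.1) L ->
  (forall u, \sum_(q <- L) q.1 * (q.2 <= cmod (f u))%R%:R = cmod (f u)) ->
  c * \sum_(q <- L) q.1 *
        vol G [set u | q.2 <= cmod (f u)] `^ ((delta - 1) / delta)
    <= 3 * edge_sum G [set: V] (edge_defect G s f).
Proof.
move=> L0 Lf.
have /choice[y fy] u := polar_form hk (f u).
pose n u := Num.floor (y u); pose x u := y u - (n u)%:~R.
have yE u : y u = (n u)%:~R + x u by rewrite /x addrC subrK.
have x01 u : 0 <= x u <= 1.
  have := floor_itv (y u); rewrite -/(n u) intrD /x; lra.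
have [a|P [P0 P1 Px]] := @unit_interval_sample R [seq x u | u : V].
  by case/mapP => u _ ->.
have {}Px u : \sum_(p <- P) p.1 * (p.2 <= x u)%R%:R = x u.
  by apply: Px; apply: map_f; rewrite mem_enum.
pose X (q : R * R) := [set u | q.2 <= cmod (f u)].
pose tau (p : R * R) u : R[i] := rot k ((n u)%:~R + (p.2 <= x u)%R%:R).
have tauS p u : S1 k (tau p u).
  by rewrite /tau -[_%:R]/((_ : nat)%:Z%:~R) -intrD; exact: S1_rot.
have step q p : c * vol G (X q) `^ ((delta - 1) / delta) <=
    edge_sum G [set: V] (fun u v => weight G u v *
      ((q.2 <= cmod (f u))%R%:R * (q.2 <= cmod (f v))%R%:R *
         cmod (tau p u - s u v * tau p v) +
       `|(q.2 <= cmod (f u))%R%:R - (q.2 <= cmod (f v))%R%:R|)).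
  apply: le_trans (isoperimetric_le (X q) hdelta hiso (tauS p)) _.
  rewrite edge_sum_restrict cut_edge_sum edge_sumD; apply: ler_edge_sum => u v _.
  by rewrite /edge_defect !inE le_eqVlt; apply/orP; left; apply/eqP; ring.
have -> : c * \sum_(q <- L) q.1 * vol G (X q) `^ ((delta - 1) / delta) =
    \sum_(q <- L) q.1 * \sum_(p <- P) p.1 * (c * vol G (X q) `^ ((delta - 1) / delta)).
  rewrite mulr_sumr; apply: eq_bigr => q _.
  by rewrite -mulr_suml P1 mul1r mulrCA.
apply: le_trans (_ : _ <= \sum_(q <- L) q.1 * \sum_(p <- P) p.1 * _) _.
  rewrite big_seq [leRHS]big_seq; apply: ler_sum => q /(allP L0) q0.
  rewrite ler_wpM2l // big_seq [leRHS]big_seq; apply: ler_sum => p /(allP P0) p0.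
  by rewrite ler_wpM2l //; exact: step.
under eq_bigr do (under eq_bigr do rewrite edge_sumZ; rewrite edge_sum_sum edge_sumZ).
rewrite edge_sum_sum edge_sumZ; apply: ler_edge_sum => u v uv.
rewrite /edge_defect mulrCA.
set a := cmod (f u); set b := cmod (f v).
set C := fun p => cmod (tau p u - s u v * tau p v).
(* Averaged over levels, the product of the two indicators gives the smaller modulus and their
   distance gives |a - b|. *)
have -> : \sum_(q <- L) q.1 * \sum_(p <- P) p.1 * (weight G u v *
      ((q.2 <= a)%R%:R * (q.2 <= b)%R%:R * C p +
       `|(q.2 <= a)%R%:R - (q.2 <= b)%R%:R|)) =
    weight G u v * (Num.min a b * \sum_(p <- P) p.1 * C p + `|a - b|).
  rewrite -(layer_min (Lf u) (Lf v)) -(layer_dist (Lf u) (Lf v)) -/a -/b.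
  rewrite mulr_suml -big_split mulr_sumr; apply: eq_bigr => q _ /=.
  rewrite -[X in _ = _ * (_ + _ * X)]mulr1 -P1 !mulr_sumr -big_split !mulr_sumr /=.
  by apply: eq_bigr => p _; ring.
rewrite ler_wpM2l ?(ltW (weight_gt0 uv)) //.
(* The signature rotates by an integer [m]: it shifts the floor of the second phase to [n v + m] and
   keeps the fractional part, so rounding commutes with it. *)
have [m sm] := S1_is_rot (hs u v uv).1.
have E := expected_rounding hk (n u) (n v + m) P1 (Px u) (Px v) P0 (x01 u) (x01 v).
apply: le_trans (_ : Num.min a b * cmod (rot k (y u) - rot k (m%:R + y v)) + `|a - b| <= _).
  rewrite lerD2r ler_wpM2l ?le_min ?cmod_ge0 //.
  have -> : m%:R + y v = (n v + m)%:~R + x v by rewrite yE intrD addrA [m%:R + _]addrC.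
  rewrite yE; apply: le_trans E; rewrite le_eqVlt; apply/orP; left; apply/eqP.
  apply: eq_bigr => p _; congr (_ * cmod (_ - _)).
  by rewrite /tau sm -rotD intrD addrA [m%:R + _]addrC.
rewrite [f u]fy [f v]fy -/a -/b sm mulrCA -rotD.
by apply: polar_dist; rewrite ?cmod_ge0 // cmod_rot.
Qed.

End Graph.

Theorem theorem3p4 (R : realType) (V : finType) (G : weighted_graph R V)
    (k : nat) (hk : (0 < k)%N) (s : V -> V -> R[i]) (hs : is_signature G k s)
    (delta : R) (hdelta : 1 < delta) (c : R) (hc : 0 < c)
    (hiso : has_isoperimetric_dimension G k s delta c)
    (f : V -> R[i]) :
  (\sum_(u : V) cmod (f u) `^ (delta / (delta - 1)) * vmeasure G u)
      `^ ((delta - 1) / delta)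
  <= 3 / c * edge_sum G [set: V]
               (fun u v => weight G u v * cmod (f u - s u v * f v)).
Proof.
have [a|L [L0 LA]] := @layer_sample R [seq cmod (f u) | u : V].
  by case/mapP => u _ ->; exact: cmod_ge0.
have Lf u : \sum_(q <- L) q.1 * (q.2 <= cmod (f u))%R%:R = cmod (f u).
  by apply: LA; apply: map_f; rewrite mem_enum.
(* For p = delta / (delta - 1), the power 1/p in Minkowski's inequality is the isoperimetric
   exponent. *)
have p1 : 1 < delta / (delta - 1) by rewrite ltr_pdivlMr; lra.
rewrite -(invf_div delta) mulrAC ler_pdivlMr // mulrC.
apply: le_trans (coarea_inequality hk hs hdelta hiso L0 Lf).
rewrite ler_pM2l // -(invf_div delta).
apply: le_trans (layer_minkowski L0 p1 (vmeasure_gt0 G) (fun u => cmod_ge0 (f u)) Lf) _.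
rewrite le_eqVlt; apply/orP; left; apply/eqP; apply: eq_bigr => q _.
by congr (_ * _ `^ _); apply: eq_bigl => u; rewrite inE.
Qed.
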